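(* One has $\mathring\mu_5(3\mid 2)_1\le 6$.
   Context: $\mathbb{R}^n$ and $\Lambda^2(\mathbb{R}^n)$ carry their canonical Euclidean norms. **Rational subspaces.** A linear subspace $B$ of $\mathbb{R}^n$ is rational if it has a basis of vectors with rational coordinates; $\mathfrak{R}_n(e)$ is the set of rational subspaces of $\mathbb{R}^n$ of dimension $e$. **Height.** For $B\in\mathfrak{R}_n(e)$, the Plücker coordinates of $B$ are the $\binom{n}{e}$ minors of size $e\times e$ of an $n\times e$ matrix whose columns form a basis of $B$ (well defined up to a nonzero scalar); choosing a representative $\Xi$ with integer coordinates with gcd $1$, set $H(B)=\|\Xi\|$ (Euclidean norm). **Angles.** For nonzero $X,Y\in\mathbb{R}^n$ let $\psi(X,Y)=\|X\wedge Y\|/(\|X\|\,\|Y\|)$ (sine of the angle). For subspaces $A,B$ of dimensions $d,e\ge 1$ and $t=\min(d,e)$, define $\psi_1(A,B),\dots,\psi_t(A,B)$ recursively: $\psi_1(A,B)=\min\psi(X,Y)$ over $X\in A\setminus\{0\}$, $Y\in B\setminus\{0\}$, attained at unit vectors $X_1,Y_1$; given $(X_1,Y_1),\dots,(X_j,Y_j)$, $\psi_{j+1}(A,B)=\min\psi(X,Y)$ over nonzero $X\in A$ orthogonal to $X_1,\dots,X_j$ and nonzero $Y\in B$ orthogonal to $Y_1,\dots,Y_j$, attained at unit vectors $X_{j+1},Y_{j+1}$. (These numbers do not depend on the choices.) **Irrationality and exponents.** Let $d,e\in\{1,\dots,n-1\}$ with $d+e\le n$ and $1\le j\le\min(d,e)$.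 $\mathfrak{I}_n(d,e)_j$ is the set of $d$-dimensional subspaces $A$ of $\mathbb{R}^n$ with $\dim(A\cap B)<j$ for all $B\in\mathfrak{R}_n(e)$. For $A\in\mathfrak{I}_n(d,e)_j$, $\mu_n(A\mid e)_j\in(0,+\infty]$ is the supremum of the $\beta>0$ such that $\psi_j(A,B)\le H(B)^{-\beta}$ for infinitely many $B\in\mathfrak{R}_n(e)$. Finally $\mathring\mu_n(d\mid e)_j=\inf_{A\in\mathfrak{I}_n(d,e)_j}\mu_n(A\mid e)_j$. *)

(* Defs.v *)
From mathcomp Require Import all_boot all_order all_algebra.
From mathcomp Require Import boolp classical_sets cardinality reals
  constructive_ereal ereal exp.

Set Implicit Arguments.
Unset Strict Implicit.
Unset Printing Implicit Defensive.

Import Order.TTheory GRing.Theory Num.Theory.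

Local Open Scope classical_set_scope.
Local Open Scope ring_scope.

Section Definitions.
Variables (R : realType) (n : nat).
Implicit Types (x y : 'rV[R]_n) (A B : {vspace 'rV[R]_n}).

Definition dotp x y : R := \sum_(i < n) x 0 i * y 0 i.

(* The library norm on matrices is the sup norm, hence this definition. *)
Definition enorm x : R := Num.sqrt (dotp x x).

(* The Euclidean norm of x /\ y in the canonical orthonormal basis
   (e_i /\ e_j)_(i < j) of the exterior square. *)
Definition wedge_norm x y : R :=
  Num.sqrt (\sum_(i < n) \sum_(j < n | (i < j)%N)
    (x 0 i * y 0 j - x 0 j * y 0 i) ^+ 2).

Definition sin_angle x y : R := wedge_norm x y / (enorm x * enorm y).

Definition rational_subspace B : Prop :=
  exists2 b : seq 'rV[R]_n, basis_of B b &
    forall v, v \in b -> forall i, exists q : rat, v 0 i = ratr q.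

Definition rational_subspaces (e : nat) : set {vspace 'rV[R]_n} :=
  [set B | rational_subspace B /\ \dim B = e].

(* The e x e minors of an e x n matrix are indexed by the strictly increasing
   maps from 'I_e to 'I_n. *)
Definition increasing (e : nat) (f : {ffun 'I_e -> 'I_n}) : bool :=
  [forall i : 'I_e, forall j : 'I_e, (i < j)%N ==> (f i < f j)%N].

Definition plucker (e : nat) (b : e.-tuple 'rV[R]_n)
    (f : {ffun 'I_e -> 'I_n}) : R :=
  \det (\matrix_(i < e, k < e) tnth b i 0 (f k)).

(* Values of Xi outside of the increasing maps are irrelevant. *)
Definition primitive_plucker (e : nat) B
    (Xi : {ffun 'I_e -> 'I_n} -> int) : Prop :=
  \big[gcdn/0%N]_(f | increasing f) `|Xi f|%N = 1%N /\
  exists (b : e.-tuple 'rV[R]_n) (c : R),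
    [/\ basis_of B b, c != 0 &
        forall f, increasing f -> (Xi f)%:~R = c * plucker b f].

(* A rational subspace B of dimension e has exactly two primitive vectors of
   Plucker coordinates, opposite to each other, so that the set below is then
   a singleton; the default value 0 is only used for other B. *)
Definition height (e : nat) B : R :=
  xget 0 [set h | exists2 Xi : {ffun 'I_e -> 'I_n} -> int,
    primitive_plucker B Xi &
    h = Num.sqrt (\sum_(f | increasing f) (Xi f)%:~R ^+ 2)].

Definition admissible A B (s : seq ('rV[R]_n * 'rV[R]_n)) :
    set ('rV[R]_n * 'rV[R]_n) :=
  [set p | [/\ p.1 \in A, p.1 != 0, p.2 \in B, p.2 != 0 &
    forall q, q \in s -> dotp p.1 q.1 = 0 /\ dotp p.2 q.2 = 0]].

Definition unit_minimizers A B (s : seq ('rV[R]_n * 'rV[R]_n)) :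
    set ('rV[R]_n * 'rV[R]_n) :=
  [set p | [/\ admissible A B s p, enorm p.1 = 1, enorm p.2 = 1 &
    forall q, admissible A B s q -> sin_angle p.1 p.2 <= sin_angle q.1 q.2]].

(* A choice of (X_1, Y_1), ..., (X_j, Y_j); by compactness, minimizers exist
   as long as j <= min (\dim A) (\dim B). *)
Fixpoint principal_pairs A B (j : nat) : seq ('rV[R]_n * 'rV[R]_n) :=
  if j is i.+1 then
    let s := principal_pairs A B i in
    rcons s (xget (0, 0) (unit_minimizers A B s))
  else [::].

(* psi_j(A, B), for 1 <= j <= min (\dim A) (\dim B); the infimum is then a
   minimum. *)
Definition psi (j : nat) A B : R :=
  inf [set sin_angle p.1 p.2 | p in admissible A B (principal_pairs A B j.-1)].

Definition irrational_subspaces (d e j : nat) : set {vspace 'rV[R]_n} :=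
  [set A | \dim A = d /\
    forall B, rational_subspaces e B -> (\dim (A :&: B) < j)%N].

Definition exponent A (e j : nat) : \bar R :=
  ereal_sup [set beta%:E | beta in [set beta : R | 0 < beta /\
    infinite_set [set B | rational_subspaces e B /\
                          psi j A B <= height e B `^ (- beta)]]].

End Definitions.

Definition min_exponent (R : realType) (n d e j : nat) : \bar R :=
  ereal_inf [set exponent A e j | A in @irrational_subspaces R n d e j].

(* Main.v *)
Require Import Defs.
From mathcomp Require Import all_boot all_order all_algebra perm.
From mathcomp Require Import boolp classical_sets cardinality reals
  constructive_ereal ereal exp.
From mathcomp Require Import ring lra zify.

Set Implicit Arguments.
Unset Strict Implicit.
Unset Printing Implicit Defensive.

Import Order.TTheory GRing.Theory Num.Theory.

Local Open Scope ring_scope.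

(** A single space [A] with exponent at most 6 (in fact at most 5) suffices.
    Let [a] in ]0, 1[ be a root of the quintic [X^5 + X^2 - 1], and let [A] be
    the common kernel in R^5 of the two linear forms [L1 x = \sum_i x_i a^i]
    and [L2 x = \sum_i x_i a^(2i)].

    A rational plane [B] is described by its primitive integral Pluecker
    coordinates, seen as an antisymmetric matrix [w]. The space [A] meets [B]
    if and only if [L1 /\ L2] vanishes at [w], that is if and only if
    [P.[a] = 0], where [P] is the integral polynomial
    [\sum_(i, j) w_ij X^(i + 2j)] ([plane_form w]). Quantitatively,
    [|P.[a]|] is at most a constant times [psi_1(A, B) H(B)]
    ([plane_form_le_sin]). It remains to bound [|P.[a]|] from below.

    Let [C] be a companion matrix of the quintic. Liouville's argument, applied
    to the norm [\det P(C)] of [P.[a]], gives [|P.[a]| >= c H(B)^-4] as soon as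
    this integer is nonzero ([liouville_char_poly]). It is even odd. Indeed
    some [w_ij] is odd, so modulo 2 the matrix [w] is the exterior product
    of its rows [u] and [v] of indices [i] and [j]; seen as
    polynomials of degree at most 4, they give [P = u(X) v(X^2) - v(X) u(X^2)].
    As squaring is the Frobenius endomorphism over F_2, this is
    [u v^2 - v u^2 = u v (v - u)], a product of three nonzero polynomials of
    degree at most 4, while the quintic is irreducible over F_2
    ([plane_form_det]).

    Hence [psi_1(A, B) >= K H(B)^-5] for all rational planes [B], with [K > 0]
    ([sin_angle_lower_bound]). This shows that [A] meets no rational plane, and
    that for [beta > 6] the inequality [psi_1(A, B) <= H(B)^-beta] forces
    [H(B) <= 1/K], which leaves finitely many [B] ([finite_height_le]). *)

(** * A quintic irreducible modulo 2 *)

Definition quintic (T : nzRingType) : {poly T} := 'X^5 + 'X^2 - 1.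

Lemma size_quintic (T : nzRingType) : size (quintic T) = 6%N.
Proof.
rewrite /quintic -addrA size_polyDl size_polyXn //.
by rewrite (leq_ltn_trans (size_polyD _ _)) // size_polyN size_polyXn size_poly1.
Qed.

Lemma monic_quintic (T : nzRingType) : quintic T \is monic.
Proof.
by rewrite monicE lead_coefE size_quintic /quintic !(coefD, coefN, coefXn, coef1)
  addr0 subr0.
Qed.

Lemma map_quintic (S T : nzRingType) (g : {rmorphism S -> T}) :
  map_poly g (quintic S) = quintic T.
Proof. by rewrite /quintic rmorphB rmorphD /= !map_polyXn rmorph1. Qed.

(** The companion matrix, with its size [(size (quintic T)).-1] turned into the
    literal 5. *)
Lemma quintic_matrix (T : comNzRingType) :
  exists C : 'M[T]_5, char_poly C = quintic T.
Proof.
move: (companionmxK (monic_quintic T)); move: (companionmx _).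
by rewrite size_quintic => C eqC; exists C.
Qed.

Lemma F2_addE (x y : 'F_2) : (x + y == 1) = (x == 1) (+) (y == 1).
Proof. by case: x y => [[|[|]]] // ? [[|[|]]]. Qed.

Lemma F2_mulE (x y : 'F_2) : (x * y == 1) = (x == 1) && (y == 1).
Proof. by case: x y => [[|[|]]] // ? [[|[|]]]. Qed.

Lemma F2_eq1 (x : 'F_2) : (x == 1) = (x != 0).
Proof. by case: x => [[|[|]]]. Qed.

(** A factorization with [size d <= 3] is a system of 8 equations over F_2 in
    the 3 + 6 coefficients of [d] and [e]; the 2^9 cases are checked. *)
Lemma quintic_small_factor (d e : {poly 'F_2}) :
  quintic 'F_2 = d * e -> (size d <= 3)%N -> (size d <= 1)%N.
Proof.
move=> fde sd.
have f0 : quintic 'F_2 != 0 by rewrite -size_poly_eq0 size_quintic.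
have d0 : d != 0 by apply: contraNneq f0 => d0; rewrite fde d0 mul0r.
have e0 : e != 0 by apply: contraNneq f0 => e0; rewrite fde e0 mulr0.
have se : (size e <= 6)%N.
  have : (0 < size d)%N by rewrite size_poly_gt0.
  have : 6%N = (size d + size e).-1 by rewrite -size_mul // -fde size_quintic.
  lia.
have dz i : (2 < i)%N -> d`_i = 0 by move=> li; rewrite nth_default // (leq_trans sd).
have ez i : (5 < i)%N -> e`_i = 0 by move=> li; rewrite nth_default // (leq_trans se).
have E k : ((k == 0) || (k == 2) || (k == 5)) =
    (\sum_(i < k.+1) d`_i * e`_(k - i) == 1).
  rewrite -coefM -fde /quintic !(coefD, coefN, coefXn, coef1).
  by case: k => [|[|[|[|[|[|k]]]]]].
have : (d`_1 == 1) = false /\ (d`_2 == 1) = false.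
  have := (E 0, E 1, E 2, E 3, E 4, E 5, E 6, E 7)%N.
  rewrite !big_ord_recr !big_ord0 /= !subSS !subn0.
  rewrite !(dz 3, dz 4, dz 5, dz 6, dz 7, ez 6, ez 7) //.
  rewrite !(mul0r, mulr0, addr0, add0r) !F2_addE !F2_mulE.
  move: (d`_1 == 1) (d`_2 == 1) (e`_3 == 1) (e`_4 == 1) (e`_5 == 1).
  move: (d`_0 == 1) (e`_0 == 1) (e`_1 == 1) (e`_2 == 1); clear.
  move=> + + + + + + + + + [[[[[[[]]]]]]].
  (* The equation in degree 0 forces both constant coefficients to be 1, which
     prunes the case analysis. *)
  case=> [] [] //= e1 e2 + + e3 e4 e5 _.
  by do 2![case] => //=; move: e1 e2 e3 e4 e5; do 5![case].
rewrite !F2_eq1 => -[/negbFE /eqP d1 /negbFE /eqP d2].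
apply/leq_sizeP => -[|[|[|j]]] // _; exact: dz.
Qed.

Lemma quintic_factor (d e : {poly 'F_2}) :
  quintic 'F_2 = d * e -> (size d <= 1)%N || (size e <= 1)%N.
Proof.
move=> fde.
have f0 : quintic 'F_2 != 0 by rewrite -size_poly_eq0 size_quintic.
have d0 : d != 0 by apply: contraNneq f0 => d0; rewrite fde d0 mul0r.
have e0 : e != 0 by apply: contraNneq f0 => e0; rewrite fde e0 mulr0.
have sz : 6%N = (size d + size e).-1 by rewrite -size_mul // -fde size_quintic.
have sd0 : (0 < size d)%N by rewrite size_poly_gt0.
have se0 : (0 < size e)%N by rewrite size_poly_gt0.
apply/orP; have [d3|d4] := leqP (size d) 3%N.
  by left; apply: quintic_small_factor fde d3.
by right; apply: (quintic_small_factor (etrans fde (mulrC _ _))); lia.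
Qed.

Lemma quintic_irreducible_F2 : irreducible_poly (quintic 'F_2).
Proof.
split=> [|q q1 /dvdpP[e fe]]; first by rewrite size_quintic.
have f0 : quintic 'F_2 != 0 by rewrite -size_poly_eq0 size_quintic.
have q0 : q != 0 by apply: contraNneq f0 => q0; rewrite fe q0 mulr0.
have e0 : e != 0 by apply: contraNneq f0 => e0; rewrite fe e0 mul0r.
have := quintic_factor fe.
rewrite (leq_eqVlt (size q)) (negbTE q1) ltnS leqn0 size_poly_eq0 (negbTE q0) !orbF.
move=> e1; have /size_poly1P[c c0 ec] : size e == 1%N.
  by rewrite eqn_leq e1 size_poly_gt0.
by rewrite fe ec mul_polyC eqp_sym eqp_scale.
Qed.

(** A Bezout relation between the quintic and [u], evaluated at [C], is an
    inverse of [u(C)] since the quintic kills [C]. *)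
Lemma quintic_horner_det (C : 'M['F_2]_5) (u : {poly 'F_2}) :
  char_poly C = quintic 'F_2 -> u != 0 -> (size u <= 5)%N ->
  \det (horner_mx C u) != 0.
Proof.
move=> charC u0 su.
have : coprimep (quintic 'F_2) u.
  rewrite (irreducible_poly_coprime _ quintic_irreducible_F2).
  by apply/negP => /(dvdp_leq u0); rewrite size_quintic leqNgt ltnS su.
case/Bezout_eq1_coprimepP => -[a b] /= /(congr1 (horner_mx C)).
rewrite rmorphD !rmorphM rmorph1 /= -charC Cayley_Hamilton mulr0 add0r.
move=> /(congr1 determinant); rewrite detM det1 => eq1.
by apply: contra_eq_neq eq1 => ->; rewrite mulr0 eq_sym oner_eq0.
Qed.

(** * The polynomial attached to a bivector *)

(** For antisymmetric [w] this is the pairing of the bivector [w] with the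
    exterior product of the forms of coefficients [X^i] and [X^(2i)]. Summing
    over all ordered pairs takes care of both signs. *)
Definition plane_form (T : nzRingType) (w : 'M[T]_5) : {poly T} :=
  \sum_(i < 5) \sum_(j < 5) w i j *: 'X^(i + j.*2).

Lemma map_plane_form (S T : nzRingType) (g : {rmorphism S -> T}) (w : 'M[S]_5) :
  map_poly g (plane_form w) = plane_form (map_mx g w).
Proof.
rewrite /plane_form rmorph_sum; apply: eq_bigr => i _.
rewrite rmorph_sum; apply: eq_bigr => j _.
by rewrite /= map_polyZ map_polyXn mxE.
Qed.

Definition row_poly (T : nzRingType) (x : 'rV[T]_5) : {poly T} :=
  \sum_(k < 5) x 0 k *: 'X^k.

Lemma coef_row_poly (T : nzRingType) (x : 'rV[T]_5) (k : 'I_5) :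
  (row_poly x)`_k = x 0 k.
Proof.
rewrite coef_sum (bigD1 k) //= coefZ coefXn eqxx mulr1 big1 ?addr0 // => i ik.
rewrite coefZ coefXn (_ : (k == i :> nat) = false) ?mulr0 //.
by apply/negbTE; rewrite eq_sym.
Qed.

Lemma size_row_poly (T : nzRingType) (x : 'rV[T]_5) :
  (size (row_poly x) <= 5)%N.
Proof.
apply/leq_sizeP => j j5; rewrite coef_sum big1 // => i _.
by rewrite coefZ coefXn gtn_eqF ?mulr0 // (leq_trans (ltn_ord i)).
Qed.

(** The Frobenius endomorphism of [{poly 'F_2}] fixes the coefficients. *)
Lemma row_poly_sqr (x : 'rV['F_2]_5) :
  row_poly x ^+ 2 = \sum_(k < 5) x 0 k *: 'X^(k.*2).
Proof.
have ch2 : 2%N \in [pchar {poly 'F_2}] by rewrite pchar_poly pchar_Fp.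
rewrite -(pFrobenius_autE ch2) /row_poly rmorph_sum; apply: eq_bigr => k _.
rewrite /= pFrobenius_autE exprZn -exprM muln2; congr (_ *: _).
by case: (x 0 k) => [[|[|]]] // ?; apply/val_inj.
Qed.

(** The hypothesis is the Pluecker relation: as [w i j = 1], it says that [w] is
    the exterior product of its rows [i] and [j]. *)
Lemma plane_form_F2 (w : 'M['F_2]_5) (i j : 'I_5) : w i j = 1 ->
  (forall k l, w i k * w j l - w i l * w j k = w i j * w k l) ->
  let u := row_poly (row i w) in let v := row_poly (row j w) in
  plane_form w = u * v * (v - u).
Proof.
move=> wij rel u v.
have -> : u * v * (v - u) = u * v ^+ 2 - v * u ^+ 2 by ring.
rewrite !row_poly_sqr /u /v /row_poly !mulr_suml -sumrB.
apply: eq_bigr => k _; rewrite !mulr_sumr -sumrB; apply: eq_bigr => l _.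
rewrite -!scalerAl -!scalerAr !scalerA -exprD -scalerBl !mxE -[w k l]mul1r -wij.
by rewrite -rel [w j k * _]mulrC.
Qed.

(** The determinant is the norm of the value of [plane_form w] at a root of
    the quintic. Reduced modulo 2 it is a product of three nonzero factors. *)
Lemma plane_form_det (C : 'M[int]_5) (w : 'M[int]_5) (i j : 'I_5) :
  char_poly C = quintic int ->
  (forall k l, w i k * w j l - w i l * w j k = w i j * w k l) ->
  ~~ (2 %| `|w i j|)%N -> \det (horner_mx C (plane_form w)) != 0.
Proof.
move=> charC rel odd_wij.
pose r := map_mx (intr : int -> 'F_2) : 'M[int]_5 -> 'M['F_2]_5.
have charCr : char_poly (r C) = quintic 'F_2.
  by rewrite -map_char_poly charC map_quintic.
have w1 : r w i j = 1.
  apply/eqP; rewrite F2_eq1 mxE -(dvdz_pcharf (pchar_Fp _)) //.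
have relr k l : r w i k * r w j l - r w i l * r w j k = r w i j * r w k l.
  by rewrite !mxE -!rmorphM -rmorphB rel.
apply: contra_neq (_ : \det (horner_mx (r C) (plane_form (r w))) != 0) => [|].
  by rewrite -map_plane_form -map_horner_mx det_map_mx => ->; rewrite rmorph0.
rewrite (plane_form_F2 w1 relr) rmorphM rmorphM /= !detM.
set u := row_poly _; set v := row_poly _.
have uE (k : 'I_5) : u`_k = r w i k by rewrite coef_row_poly mxE.
have vE (k : 'I_5) : v`_k = r w j k by rewrite coef_row_poly mxE.
(* The rows [i] and [j] are independent modulo 2, so that none of [u], [v] and
   [v - u] vanishes. *)
have minor : u`_i * v`_j - u`_j * v`_i = 1 by rewrite !uE !vE relr w1 mulr1.
rewrite !mulf_neq0 // quintic_horner_det ?size_row_poly //.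
- apply: contra_eq_neq minor => ->; rewrite !coef0 !mul0r subr0.
  by rewrite eq_sym oner_eq0.
- by apply: contra_eq_neq minor => ->; rewrite !coef0 !mulr0 subr0 eq_sym oner_eq0.
- rewrite subr_eq0; apply: contra_eq_neq minor => ->.
  by rewrite mulrC subrr eq_sym oner_eq0.
- by rewrite (leq_trans (size_polyD _ _)) // size_polyN geq_max !size_row_poly.
Qed.

(** * Liouville's inequality *)

Lemma det_norm_le (R : numDomainType) n (A : 'M[R]_n) (k : R) :
  (forall i j, `|A i j| <= k) -> `|\det A| <= (n`!)%:R * k ^+ n.
Proof.
move=> leA; apply: le_trans (ler_norm_sum _ _ _) _.
have -> : (n`!)%:R * k ^+ n = \sum_(s : 'S_n) k ^+ n.
  by rewrite sumr_const card_Sn mulr_natl.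
apply: ler_sum => s _; rewrite normrM normrX normrN1 expr1n mul1r normr_prod.
rewrite -[n in X in _ <= X]card_ord -prodr_const.
by apply: ler_prod => i _; rewrite normr_ge0 leA.
Qed.

Lemma adj_norm_le (R : numDomainType) n (A : 'M[R]_n.+1) (k : R) :
  (forall i j, `|A i j| <= k) -> forall i j, `|\adj A i j| <= (n`!)%:R * k ^+ n.
Proof.
move=> leA i j; rewrite mxE /cofactor normrM normrX normrN1 expr1n mul1r.
by apply: det_norm_le => i' j'; rewrite !mxE.
Qed.

Lemma eigen_horner_mx (F : fieldType) n (C : 'M[F]_n.+1) (v : 'rV[F]_n.+1) a p :
  v *m C = a *: v -> v *m horner_mx C p = p.[a] *: v.
Proof.
move=> vC; elim/poly_ind: p => [|p c IHp].
  by rewrite rmorph0 mulmx0 horner0 scale0r.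
rewrite rmorphD rmorphM /= horner_mx_X horner_mx_C mulmxDr mulmxA IHp.
by rewrite -scalemxAl vC scalerA mul_mx_scalar -scalerDl hornerMXaddC.
Qed.

Lemma horner_mx_norm_le (R : numFieldType) n m (C : 'M[R]_n.+1) :
  exists2 K : R, 0 < K & forall (p : {poly R}) (h : R), (size p <= m)%N ->
    (forall i, `|p`_i| <= h) -> forall i j, `|horner_mx C p i j| <= K * h.
Proof.
exists (1 + \sum_(k < m) \sum_i \sum_j `|(C ^+ k) i j|).
  by rewrite ltr_wpDr ?ltr01 //; do 3!apply: sumr_ge0 => ? _.
move=> p h szp leh i j; have h0 : 0 <= h by apply: le_trans (leh 0%N).
have -> : horner_mx C p = \sum_(k < m) p`_k *: C ^+ k.
  have {1}-> : p = \poly_(k < m) p`_k.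
    apply/polyP => k; rewrite coef_poly; case: ltnP => // mk.
    by rewrite nth_default // (leq_trans szp).
  rewrite poly_def rmorph_sum; apply: eq_bigr => k _.
  by rewrite /= linearZ /= rmorphXn /= horner_mx_X.
rewrite summxE mulrDl mul1r (le_trans (ler_norm_sum _ _ _)) //.
rewrite (@le_trans _ _ (\sum_(k < m) `|(C ^+ k) i j| * h)) //.
  by apply: ler_sum => k _; rewrite mxE normrM mulrC ler_wpM2l.
rewrite -mulr_suml ler_wpDl // ler_wpM2r // ler_sum // => k _.
rewrite (bigD1 i) //= (bigD1 j) //= -addrA lerDl addr_ge0 ?sumr_ge0 // => i' _.
by rewrite sumr_ge0.
Qed.

(** Liouville's inequality, without conjugates: if [v] is a row eigenvector of
    [C] for [a] and [M = p(C)], then [v M = p(a) v], hence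
    [p(a) (v adj M) = (\det M) v], where [|\det M| >= 1] and the entries of
    [adj M] are bounded by a multiple of [h^n]. *)
Lemma liouville_char_poly (R : rcfType) n m (C : 'M[int]_n.+1) (a : R) :
  root (map_poly intr (char_poly C)) a ->
  exists2 c : R, 0 < c & forall (p : {poly int}) (h : R), (size p <= m)%N ->
    (forall i, `|(p`_i)%:~R| <= h) -> \det (horner_mx C p) != 0 ->
    c <= `|(map_poly intr p).[a]| * h ^+ n.
Proof.
rewrite map_char_poly -eigenvalue_root_char => /eigenvalueP[v vC /rV0Pn[k vk]].
have [K K0 leK] := horner_mx_norm_le m (map_mx intr C : 'M[R]_n.+1).
pose s := \sum_i `|v 0 i|; pose D : R := s * ((n`!)%:R * K ^+ n).
have s0 : 0 < s.
  by rewrite /s (bigD1 k) //= ltr_wpDr ?sumr_ge0 // normr_gt0.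
have D0 : 0 < D by rewrite !mulr_gt0 // ?exprn_gt0 // ltr0n fact_gt0.
exists (`|v 0 k| / D); first by rewrite divr_gt0 // normr_gt0.
move=> p h szp leh det0; rewrite ler_pdivrMr //.
pose M : 'M[R]_n.+1 := horner_mx (map_mx intr C) (map_poly intr p).
have leM i j : `|M i j| <= K * h.
  apply: leK => [|l]; first by rewrite size_map_inj_poly //; apply: intr_inj.
  by rewrite coef_map leh.
have h0 : 0 <= h by apply: le_trans (leh 0%N).
have det1 : 1 <= `|\det M|.
  by rewrite /M -map_horner_mx det_map_mx -intr_norm ler1z -gtz0_ge1 normr_gt0.
have eqv : (map_poly intr p).[a] *: (v *m \adj M) = \det M *: v.
  by rewrite scalemxAl -(eigen_horner_mx _ vC) -mulmxA mul_mx_adj mul_mx_scalar.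
apply: (@le_trans _ _ (`|(\det M *: v) 0 k|)).
  by rewrite mxE normrM ler_peMl.
rewrite -eqv mxE normrM -mulrA ler_wpM2l // mxE (le_trans (ler_norm_sum _ _ _)) //.
have -> : h ^+ n * D = \sum_i `|v 0 i| * ((n`!)%:R * (K * h) ^+ n).
  by rewrite -mulr_suml -/s /D exprMn; ring.
by apply: ler_sum => i _; rewrite normrM ler_wpM2l // adj_norm_le.
Qed.

(** * Pluecker coordinates of rational planes *)

(** Multiply by the product of the denominators and divide by the gcd. The
    latter is only taken over [P], whence the restriction in the last clause. *)
Lemma primitive_multiple (I : finType) (P : pred I) (r : I -> rat) :
  (exists2 i, P i & r i != 0) ->
  exists (z : I -> int) (c : rat), [/\ c != 0,
    \big[gcdn/0%N]_(i | P i) `|z i|%N = 1%N &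
    forall i, P i -> (z i)%:~R = c * r i].
Proof.
case=> i0 Pi0 ri0.
pose D : int := \prod_i denq (r i).
pose m i : int := numq (r i) * \prod_(j | j != i) denq (r j).
have D0 : D != 0 by apply/prodf_neq0 => i _; rewrite denq_neq0.
have mE i : (m i)%:~R = D%:~R * r i.
  have -> : D = denq (r i) * \prod_(j | j != i) denq (r j) by rewrite /D (bigD1 i).
  by rewrite /m !intrM numqE; ring.
pose G := \big[gcdn/0%N]_(i | P i) `|m i|%N.
have Gdvd i : P i -> (G %| `|m i|)%N by move=> Pi; apply: biggcdn_inf Pi _.
have G0 : (0 < G)%N.
  rewrite lt0n; apply: contra_neq ri0 => G0; move: (Gdvd _ Pi0).
  rewrite G0 dvd0n absz_eq0 => /eqP m0; have := mE i0; rewrite m0 => /esym/eqP.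
  by rewrite mulf_eq0 intr_eq0 (negbTE D0) => /eqP.
pose z i : int := (m i %/ G)%Z.
have zE i : P i -> z i * G = m i by move=> Pi; rewrite divzK // dvdzE /= Gdvd.
exists z, (D%:~R / G%:R); split=> [||i Pi].
- by rewrite mulf_neq0 ?invr_neq0 ?intr_eq0 // pnatr_eq0 -lt0n.
- set d := \big[_/_]_(_ | _) _.
  suff : (d * G %| 1 * G)%N by rewrite dvdn_pmul2r // dvdn1 => /eqP.
  rewrite mul1n; apply/dvdn_biggcdP => i Pi.
  by rewrite -zE // abszM dvdn_mul //= /d (biggcdn_inf i).
- rewrite mulrAC -mE -(zE _ Pi) intrM mulfK //.
  by rewrite pnatr_eq0 -lt0n.
Qed.

Definition pair_fun n (i j : 'I_n) : {ffun 'I_2 -> 'I_n} :=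
  [ffun k => if k == 0 then i else j].

Lemma increasing_pair n (i j : 'I_n) : increasing (pair_fun i j) = (i < j)%N.
Proof.
apply/forallP/idP => [/(_ 0)/forallP/(_ 1)|ij k]; first by rewrite !ffunE.
apply/forallP => l; rewrite !ffunE.
by case: k l => [[|[|]]] // ? [[|[|]]].
Qed.

Lemma plucker_pair (R : realType) n (b : 2.-tuple 'rV[R]_n) f :
  plucker b f = tnth b 0 0 (f 0) * tnth b 1 0 (f 1)
              - tnth b 0 0 (f 1) * tnth b 1 0 (f 0).
Proof.
rewrite /plucker (expand_det_row _ 0) !big_ord_recl big_ord0 /cofactor !det_mx11.
rewrite !mxE /= addr0 expr0 mul1r mulN1r mulrN.
have -> : lift 0 0 = 1 :> 'I_2 by apply: val_inj.
by have -> : lift 1 0 = 0 :> 'I_2 by apply: val_inj.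
Qed.

(** The Pluecker coordinates of a plane as an antisymmetric matrix, which
    dispenses with increasing maps as indices. *)
Definition plucker_matrix (R : realType) n (B : {vspace 'rV[R]_n})
    (w : 'M[int]_n) : Prop :=
  exists x y (c : R), [/\ basis_of B [:: x; y], c != 0 &
    forall i j, (w i j)%:~R = c * (x 0 i * y 0 j - x 0 j * y 0 i)].

(** If all minors vanish then [x] is a multiple of [y]. *)
Lemma basis_pair_minor (K : fieldType) n (B : {vspace 'rV[K]_n})
    (x y : 'rV[K]_n) :
  basis_of B [:: x; y] ->
  exists i j : 'I_n, (i < j)%N /\ x 0 i * y 0 j - x 0 j * y 0 i != 0.
Proof.
move=> bB; apply: contrapT => H.
have minor0 i j : x 0 i * y 0 j = x 0 j * y 0 i.
  have lt0 (k l : 'I_n) : (k < l)%N -> x 0 k * y 0 l = x 0 l * y 0 k.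
    move=> kl; apply/eqP; rewrite -subr_eq0; apply: contrapT => /negP ne0.
    by apply: H; exists k, l.
  by case: (ltngtP i j) => [/lt0|/lt0 ->|/val_inj ->].
have := basis_free bB; rewrite free_cons span_seq1 => /andP[/negP xy].
rewrite seq1_free => /rV0Pn[k yk]; case: xy; apply/vlineP; exists (x 0 k / y 0 k).
by apply/rowP => i; rewrite mxE mulrAC -minor0 mulfK.
Qed.

Lemma primitive_plucker_exists (R : realType) n (B : {vspace 'rV[R]_n}) :
  rational_subspaces 2 B ->
  exists Xi : {ffun 'I_2 -> 'I_n} -> int, primitive_plucker B Xi.
Proof.
case=> -[b bB ratb] dimB.
have sb : size b = 2%N by rewrite -dimB -(size_basis (X := in_tuple b) bB).
case: b sb bB ratb => [|x [|y []]] // _ bB ratb.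
have /boolp.choice[qx xE] : forall i, exists q : rat, x 0 i = ratr q.
  by move=> i; apply: ratb; rewrite mem_head.
have /boolp.choice[qy yE] : forall i, exists q : rat, y 0 i = ratr q.
  by move=> i; apply: ratb; rewrite !inE eqxx orbT.
pose r (f : {ffun 'I_2 -> 'I_n}) := qx (f 0) * qy (f 1) - qx (f 1) * qy (f 0).
have rE f : ratr (r f) = plucker [tuple x; y] f.
  by rewrite plucker_pair /r rmorphB !rmorphM /= -!xE -!yE.
have [|z [c [c0 gcd1 zE]]] := @primitive_multiple _ (@increasing n 2) r.
  have [i [j [ij ne0]]] := basis_pair_minor bB.
  exists (pair_fun i j); first by rewrite increasing_pair.
  by rewrite -(fmorph_eq0 (ratr : rat -> R)) /= rE plucker_pair !ffunE.
exists z; split=> //; exists [tuple x; y], (ratr c); split=> //.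
  by rewrite fmorph_eq0.
by move=> f incf; rewrite -rE -rmorphM -zE //= ratr_int.
Qed.

(** As primitive coordinates exist for a rational plane, its height is the norm
    of such coordinates and not the default value. Primitivity is only kept in
    the form in which it serves modulo 2. *)
Lemma primitive_plucker_matrix (R : realType) n (B : {vspace 'rV[R]_n}) :
  rational_subspaces 2 B ->
  exists w : 'M[int]_n, [/\ plucker_matrix B w,
    exists i j, ~~ (2 %| `|w i j|)%N &
    forall i j, `|(w i j)%:~R| <= height 2 B].
Proof.
move=> /primitive_plucker_exists[Xi0 prXi0]; rewrite /height.
case: xgetP => [h _ [Xi [gcd1 [b [c [bB c0 XiE]]]] ->]|/(_ _)]; last first.
  by move=> none; case: (none (Num.sqrt (\sum_(f | increasing f) (Xi0 f)%:~R ^+ 2)));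
    exists Xi0.
pose w : 'M[int]_n := \matrix_(i, j) if (i < j)%N then Xi (pair_fun i j) else
  if (j < i)%N then - Xi (pair_fun j i) else 0.
have XiP (i j : 'I_n) : (i < j)%N -> (Xi (pair_fun i j))%:~R =
    c * (tnth b 0 0 i * tnth b 1 0 j - tnth b 0 0 j * tnth b 1 0 i).
  by move=> ij; rewrite XiE ?increasing_pair // plucker_pair !ffunE.
have Xile f : increasing f ->
    `|(Xi f)%:~R : R| <= Num.sqrt (\sum_(f | increasing f) (Xi f)%:~R ^+ 2).
  move=> incf; rewrite -sqrtr_sqr ler_wsqrtr // (bigD1 f) //= lerDl.
  by apply: sumr_ge0 => g _; apply: sqr_ge0.
exists w; split.
- exists (tnth b 0), (tnth b 1), c; split=> //.
    suff <- : val b = [:: tnth b 0; tnth b 1] by [].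
    by case: (b) => -[|x [|y []]] //= ?; rewrite !(tnth_nth x).
  move=> i j; rewrite mxE; case: ltngtP => [ij|ji|/val_inj ->].
  + exact: XiP.
  + by rewrite mulrNz XiP // -mulrN opprB.
  + by rewrite subrr mulr0.
- apply: contrapT => even_w.
  have : (2 %| \big[gcdn/0%N]_(f | increasing f) `|Xi f|)%N.
    apply/dvdn_biggcdP => f incf; apply: contrapT => /negP odd_f.
    have fE : f = pair_fun (f 0) (f 1).
      by apply/ffunP => -[[|[|]] // ?]; rewrite ffunE /=; congr (f _); apply: val_inj.
    apply: even_w; exists (f 0), (f 1); rewrite mxE.
    by rewrite -increasing_pair -fE incf.
  by rewrite gcd1.
- move=> i j; rewrite mxE; case: ltngtP => [ij|ji|_].
  + by rewrite Xile // increasing_pair.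
  + by rewrite mulrNz normrN Xile // increasing_pair.
  + by rewrite normr0 sqrtr_ge0.
Qed.

Lemma plucker_matrix_rel (R : realType) n (B : {vspace 'rV[R]_n})
    (w : 'M[int]_n) :
  plucker_matrix B w ->
  forall i j k l, w i k * w j l - w i l * w j k = w i j * w k l.
Proof.
case=> x [y [c [_ _ wE]]] i j k l; apply: (@intr_inj R).
by rewrite intrB !intrM !wE; ring.
Qed.

(** The coordinates of [v /\ w], which vanishes for [v] in the plane. *)
Lemma plucker_matrix_mem (R : realType) n (B : {vspace 'rV[R]_n})
    (w : 'M[int]_n) (v : 'rV[R]_n) : plucker_matrix B w -> v \in B ->
  forall i j k, v 0 j * (w i k)%:~R - v 0 k * (w i j)%:~R = v 0 i * (w j k)%:~R.
Proof.
case=> x [y [c [bB _ wE]]]; rewrite -(span_basis bB) span_cons span_seq1.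
case/memv_addP=> _ /vlineP[s ->] [_ /vlineP[t ->] ->] i j k.
by rewrite !wE !mxE; ring.
Qed.

(** A plane is thus determined by its Pluecker coordinates, so that there are
    finitely many of bounded height. *)
Lemma plucker_matrix_span (R : realType) n (B : {vspace 'rV[R]_n})
    (w : 'M[int]_n) :
  plucker_matrix B w ->
  B = <<[seq row i (map_mx intr w) | i <- enum 'I_n]>>%VS.
Proof.
case=> x [y [c [bB c0 wE]]].
set S := <<_>>%VS.
have rowE i : row i (map_mx intr w) = c *: (x 0 i *: y - y 0 i *: x).
  by apply/rowP => j; rewrite !mxE wE; ring.
have rowS i : row i (map_mx intr w) \in S.
  by apply/memv_span/map_f; rewrite mem_enum.
apply/eqP; rewrite eqEsubv -{1}(span_basis bB); apply/andP; split.
  have [i [j [_ m0]]] := basis_pair_minor bB.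
  apply/span_subvP => v vxy.
  (* For [v] equal to [x] or [y], eliminate the other vector between the
     rows [i] and [j]. *)
  have -> : v = (c * (x 0 i * y 0 j - x 0 j * y 0 i))^-1 *:
      (v 0 j *: row i (map_mx intr w) - v 0 i *: row j (map_mx intr w)).
    apply: (scalerI (mulf_neq0 c0 m0)); rewrite scalerA mulfV ?mulf_neq0 // scale1r.
    rewrite !rowE; apply/rowP => k; rewrite !mxE.
    by move: vxy; rewrite !inE => /orP[] /eqP ->; ring.
  by rewrite memvZ // memvB // memvZ.
apply/span_subvP => _ /mapP[i _ ->]; rewrite rowE.
rewrite memvZ // memvB // memvZ //; apply: (basis_mem bB).
  by rewrite !inE eqxx orbT.
by rewrite mem_head.
Qed.

(** Such a plane is the span of the rows of an integral matrix with entries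
    in ]-N, N[, encoded by a matrix over the finite type of integers up
    to 2N after a translation by N. *)
Lemma finite_height_le (R : realType) n (r : R) :
  finite_set [set B : {vspace 'rV[R]_n} |
    rational_subspaces 2 B /\ height 2 B <= r]%classic.
Proof.
pose N := Num.bound `|r|.
pose span_of (m : 'M['I_(N + N).+1]_n) : {vspace 'rV[R]_n} :=
  <<[seq row i (map_mx (fun k : 'I_(N + N).+1 => k%:R - N%:R) m)
      | i <- enum 'I_n]>>%VS.
apply: (@sub_finite_set _ _ (span_of @` setT)%classic); last first.
  by apply: finite_image; apply: finite_finset.
move=> B [ratB hB]; have [w [plB _ wle]] := primitive_plucker_matrix ratB.
have wN i j : (`|w i j| < N)%N.
  rewrite -(ltr_nat R) -[X in X < _]/((Posz `|w i j|)%:~R) abszE intr_norm.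
  rewrite (le_lt_trans (wle i j)) // (le_lt_trans hB) //.
  by rewrite (le_lt_trans (ler_norm r)) // archi_boundP.
exists (map_mx (fun z : int => inord (absz (z + N))) w) => //.
rewrite (plucker_matrix_span plB) /span_of -map_mx_comp; congr <<_>>%VS.
apply: eq_map => i; congr (row i _); apply/matrixP => k l; rewrite !mxE /=.
have := wN k l => wkl; rewrite inordK; last by lia.
rewrite -[X in X - _]/((Posz `|w k l + N|)%:~R) gez0_abs; last by lia.
by rewrite intrD addrK.
Qed.

(** * Linear forms and angles *)

(** The value at [a] of the polynomial whose coefficients are those of [x]; the
    forms [L1] and [L2] are [ell a] and [ell (a ^+ 2)]. *)
Definition ell (R : realType) n (a : R) (x : 'rV[R]_n) : R :=
  \sum_(i < n) x 0 i * a ^+ i.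

Lemma norm_sum_le (R : numDomainType) n (F : 'I_n -> R) (k : R) :
  (forall i, `|F i| <= k) -> `|\sum_i F i| <= n%:R * k.
Proof.
move=> leF; rewrite (le_trans (ler_norm_sum _ _ _)) // mulr_natl.
by rewrite -[n in X in _ <= X]card_ord -sumr_const ler_sum.
Qed.

Lemma ell_norm_le (R : realType) n (a k : R) (x : 'rV[R]_n) :
  0 <= a <= 1 -> (forall i, `|x 0 i| <= k) -> `|ell a x| <= n%:R * k.
Proof.
move=> /andP[a0 a1] lex; apply: norm_sum_le => i.
rewrite normrM normrX (ger0_norm a0) (le_trans _ (lex i)) //.
by rewrite ler_piMr // exprn_ile1.
Qed.

Lemma coord_le_enorm (R : realType) n (x : 'rV[R]_n) i : `|x 0 i| <= enorm x.
Proof.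
rewrite -sqrtr_sqr ler_wsqrtr // /dotp (bigD1 i) //= -expr2 lerDl.
by apply: sumr_ge0 => j _; rewrite -expr2 sqr_ge0.
Qed.

Lemma sqr_enorm (R : realType) n (x : 'rV[R]_n) : enorm x ^+ 2 = dotp x x.
Proof. by rewrite sqr_sqrtr // sumr_ge0 // => j _; rewrite -expr2 sqr_ge0. Qed.

Lemma enorm_gt0 (R : realType) n (x : 'rV[R]_n) : x != 0 -> 0 < enorm x.
Proof.
by case/rV0Pn => i xi; apply: lt_le_trans (coord_le_enorm x i); rewrite normr_gt0.
Qed.

Lemma minor_le_wedge (R : realType) n (x y : 'rV[R]_n) i j :
  `|x 0 i * y 0 j - x 0 j * y 0 i| <= wedge_norm x y.
Proof.
have lt (k l : 'I_n) : (k < l)%N ->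
    `|x 0 k * y 0 l - x 0 l * y 0 k| <= wedge_norm x y.
  move=> kl; rewrite -sqrtr_sqr ler_wsqrtr // (bigD1 k) //= (bigD1 l) //=.
  rewrite -addrA lerDl addr_ge0 // ?sumr_ge0 // => [l' _|k' _]; first exact: sqr_ge0.
  by rewrite sumr_ge0 // => l' _; apply: sqr_ge0.
case: (ltngtP i j) => [/lt|/lt|/val_inj ->] //; first by rewrite distrC.
by rewrite subrr normr0 sqrtr_ge0.
Qed.

(** The form [ell a] vanishes at [x], so it takes the same value at [y] and at
    the component of [y] orthogonal to [x], of norm [sin_angle x y * enorm y].
    The argument is written for the multiple [z] of this component by
    [enorm x ^+ 2], whose coordinates are combinations of minors of [x, y]. *)
Lemma ell_sin_le (R : realType) n (a : R) (x y : 'rV[R]_n) :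
  0 <= a <= 1 -> x != 0 -> y != 0 -> ell a x = 0 ->
  `|ell a y| <= n%:R ^+ 2 * (sin_angle x y * enorm y).
Proof.
move=> a01 x0 y0 ax.
have nx := enorm_gt0 x0; have ny := enorm_gt0 y0.
pose z := enorm x ^+ 2 *: y - dotp x y *: x.
have az : ell a z = enorm x ^+ 2 * ell a y.
  transitivity (enorm x ^+ 2 * ell a y - dotp x y * ell a x).
    rewrite /ell !mulr_sumr -sumrB.
    by apply: eq_bigr => i _; rewrite !mxE; ring.
  by rewrite ax mulr0 subr0.
have zE k : z 0 k = \sum_i x 0 i * (x 0 i * y 0 k - x 0 k * y 0 i).
  rewrite !mxE sqr_enorm /dotp !mulr_suml -sumrB.
  by apply: eq_bigr => i _; ring.
have zle k : `|z 0 k| <= n%:R * (enorm x * wedge_norm x y).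
  rewrite zE norm_sum_le // => i.
  by rewrite normrM ler_pM // ?coord_le_enorm ?minor_le_wedge.
have := ell_norm_le a01 zle.
rewrite az normrM ger0_norm ?sqr_ge0 // => le.
rewrite /sin_angle -(ler_pM2l (exprn_gt0 2 nx)) (le_trans le) //.
rewrite [X in _ <= X](_ : _ = n%:R * (n%:R * (enorm x * wedge_norm x y))) //.
by field; rewrite !gt_eqF.
Qed.

(** * Lower bound for the first angle *)

Lemma horner_plane_form (R : realType) (w : 'M[int]_5) (a : R) :
  (map_poly intr (plane_form w)).[a] =
  \sum_(i < 5) \sum_(j < 5) (w i j)%:~R * (a ^+ i * (a ^+ 2) ^+ j).
Proof.
rewrite map_plane_form /plane_form horner_sum; apply: eq_bigr => i _.
rewrite horner_sum; apply: eq_bigr => j _.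
by rewrite hornerZ hornerXn mxE exprD -exprM mul2n.
Qed.

(** The largest exponent is 4 + 2 * 4. *)
Lemma size_plane_form (T : nzRingType) (w : 'M[T]_5) :
  (size (plane_form w) <= 13)%N.
Proof.
apply/leq_sizeP => k k13; rewrite coef_sum big1 // => i _.
rewrite coef_sum big1 // => j _.
by rewrite coefZ coefXn gtn_eqF ?mulr0 //; have := ltn_ord i; have := ltn_ord j; lia.
Qed.

Lemma coef_plane_form_le (R : realType) (w : 'M[int]_5) (h : R) :
  (forall i j, `|(w i j)%:~R| <= h) ->
  forall k, `|((plane_form w)`_k)%:~R| <= 5 * (5 * h).
Proof.
move=> wle k; rewrite coef_sum rmorph_sum /= norm_sum_le // => i.
rewrite coef_sum rmorph_sum /= norm_sum_le // => j.
rewrite coefZ coefXn intrM normrM (le_trans _ (wle i j)) // ler_piMr //.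
by case: eqP; rewrite ?normr1 // normr0 ler01.
Qed.

(** If [y] lies in the plane, so does its contraction [z] with [w], and
    [y /\ z = |y|^2 w]. Apply [L1 /\ L2] to both sides. *)
Lemma sqr_enorm_plane_form (R : realType) (B : {vspace 'rV[R]_5})
    (w : 'M[int]_5) (a : R) (y : 'rV[R]_5) : plucker_matrix B w -> y \in B ->
  let z := y *m map_mx intr w in
  enorm y ^+ 2 * (map_poly intr (plane_form w)).[a] =
  ell a y * ell (a ^+ 2) z - ell a z * ell (a ^+ 2) y.
Proof.
move=> plB yB z.
have zE i j : y 0 i * z 0 j - z 0 i * y 0 j = enorm y ^+ 2 * (w i j)%:~R.
  rewrite !mxE mulr_sumr mulr_suml -sumrB sqr_enorm /dotp mulr_suml.
  apply: eq_bigr => k _; rewrite !mxE -[RHS]mulrA -(plucker_matrix_mem plB yB); ring.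
rewrite horner_plane_form /ell !mulr_suml mulr_sumr -sumrB.
apply: eq_bigr => i _; rewrite !mulr_sumr -sumrB; apply: eq_bigr => j _.
by rewrite [LHS]mulrA -zE; ring.
Qed.

(** In the previous identity [L1 y] and [L2 y] are small because [y] is close to
    the line of [x], on which both forms vanish. The constant is
    2 * 5^2 * (5 * 5): two products, the factor 5^2 for the forms at [y], and
    5 * 5 for the forms at the contraction of [y] with [w]. *)
Lemma plane_form_le_sin (R : realType) (B : {vspace 'rV[R]_5}) (w : 'M[int]_5)
    (a h : R) (x y : 'rV[R]_5) : 0 <= a <= 1 ->
  plucker_matrix B w -> (forall i j, `|(w i j)%:~R| <= h) ->
  x != 0 -> ell a x = 0 -> ell (a ^+ 2) x = 0 -> y \in B -> y != 0 ->
  `|(map_poly intr (plane_form w)).[a]| <= 1250 * (sin_angle x y * h).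
Proof.
move=> a01 plB wle x0 ax a2x yB y0.
have a201 : 0 <= a ^+ 2 <= 1 by case/andP: a01 => a0 a1; rewrite exprn_ge0 ?exprn_ile1.
have ny := enorm_gt0 y0.
pose z := y *m map_mx intr w.
have zle k : `|z 0 k| <= 5 * (enorm y * h).
  rewrite mxE norm_sum_le // => i; rewrite !mxE normrM.
  by rewrite ler_pM // coord_le_enorm.
have L1z := ell_norm_le a01 zle; have L2z := ell_norm_le a201 zle.
have L1y := ell_sin_le a01 x0 y0 ax; have L2y := ell_sin_le a201 x0 y0 a2x.
rewrite -(ler_pM2l (exprn_gt0 2 ny)).
rewrite -[X in X * `|_|](ger0_norm (sqr_ge0 (enorm y))) -normrM.
rewrite (sqr_enorm_plane_form a plB yB) -/z (le_trans (ler_normB _ _)) //.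
rewrite !normrM (le_trans (lerD (ler_pM _ _ L1y L2z) (ler_pM _ _ L1z L2y))) //.
by rewrite le_eqVlt; apply/orP; left; apply/eqP; ring.
Qed.

Lemma quintic_root (R : realType) :
  exists a : R, [/\ 0 < a, a < 1 & root (quintic R) a].
Proof.
have [||a /andP[a0 a1] ra] := @poly_ivt R (quintic R) 0 1; rewrite ?ler01 //.
  by rewrite /quintic !hornerE /= !expr0n /= !expr1n; lra.
exists a; split=> //; rewrite lt_neqAle ?a0 ?a1 andbT.
  apply: contraTneq ra => <-; rewrite /root /quintic !hornerE !expr0n /=; lra.
by apply: contraTneq ra => ->; rewrite /root /quintic !hornerE !expr1n /=; lra.
Qed.

Lemma sin_angle_lower_bound (R : realType) (a : R) :
  0 < a -> a < 1 -> root (quintic R) a ->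
  exists2 K : R, 0 < K & forall (B : {vspace 'rV[R]_5}) x y,
    rational_subspaces 2 B -> x != 0 -> ell a x = 0 -> ell (a ^+ 2) x = 0 ->
    y \in B -> y != 0 -> K <= sin_angle x y * height 2 B ^+ 5.
Proof.
move=> a0 a1 ra; have [C charC] := quintic_matrix int.
have [|c c0 leP] := @liouville_char_poly R 4 13 C a; first by rewrite charC map_quintic.
have K0 : 0 < 1250 * 25 ^+ 4 :> R by rewrite mulr_gt0 ?exprn_gt0 ?ltr0n.
exists (c / (1250 * 25 ^+ 4)); first by rewrite divr_gt0.
move=> B x y ratB x0 ax a2x yB y0.
have [w [plB [i [j odd_wij]] wle]] := primitive_plucker_matrix ratB.
have h0 : 0 <= height 2 B by apply: le_trans (wle i j).
have a01 : 0 <= a <= 1 by rewrite !ltW.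
have := leP _ _ (size_plane_form w) (coef_plane_form_le wle)
  (plane_form_det charC (plucker_matrix_rel plB i j) odd_wij).
move=> le; rewrite ler_pdivrMr // (le_trans le) //.
have := plane_form_le_sin a01 plB wle x0 ax a2x yB y0.
have h4 : 0 <= (5 * (5 * height 2 B)) ^+ 4 by rewrite exprn_ge0 // !mulr_ge0.
move=> /(ler_wpM2r h4)/le_trans; apply.
by rewrite le_eqVlt; apply/orP; left; apply/eqP; ring.
Qed.

(** * The subspace and its exponent *)

Definition ell_kernel (R : realType) (a : R) : {vspace 'rV[R]_5} :=
  lker (linfun (mulmxr (\matrix_(i < 5, k < 2) (a ^+ k.+1) ^+ i))).

Lemma ell_mulmx (R : realType) (a : R) (x : 'rV[R]_5) (k : 'I_2) :
  (x *m \matrix_(i < 5, k < 2) (a ^+ k.+1) ^+ i) 0 k = ell (a ^+ k.+1) x.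
Proof. by rewrite mxE; apply: eq_bigr => i _; rewrite mxE. Qed.

Lemma ell_kernelP (R : realType) (a : R) (x : 'rV[R]_5) :
  x \in ell_kernel a -> ell a x = 0 /\ ell (a ^+ 2) x = 0.
Proof.
rewrite memv_ker lfunE /= => /eqP x0.
have E (k : 'I_2) : ell (a ^+ k.+1) x = 0 by rewrite -ell_mulmx x0 mxE.
by split; [have := E 0; rewrite expr1 | have := E 1].
Qed.

Lemma dim_ell_kernel (R : realType) (a : R) :
  0 < a -> a < 1 -> \dim (ell_kernel a) = 3%N.
Proof.
move=> a0 a1; pose f : 'Hom('rV[R]_5, 'rV[R]_2) :=
  linfun (mulmxr (\matrix_(i < 5, k < 2) (a ^+ k.+1) ^+ i)).
have a12 : a - a ^+ 2 != 0.
  by rewrite expr2 -{1}[a]mulr1 -mulrBr mulf_neq0 ?gt_eqF // subr_gt0.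
have := limg_ker_dim f fullv; rewrite capfv -/(ell_kernel a).
suff -> : limg f = fullv by rewrite !dimvf !dim_matrix => /(@addIn 2 _ 3).
apply/eqP; rewrite eqEsubv subvf /=; apply/subvP => z _.
(* Vectors supported by the first two coordinates already reach every value:
   solve [s + a t = z_0] and [s + a^2 t = z_1]. *)
pose t := (z 0 0 - z 0 1) / (a - a ^+ 2); pose s := z 0 0 - a * t.
have -> : z = f (\row_(i < 5) if i == 0 then s else if i == 1 then t else 0).
  apply/rowP => k; rewrite lfunE /= ell_mulmx /ell !big_ord_recl big_ord0 !mxE /=.
  rewrite !mul0r !addr0 expr0 mulr1 /bump /= addn0 expr1.
  case: k => [[|[|]]] //= lt.
    by rewrite expr1 /s /t; rewrite (_ : Ordinal lt = 0); [ring | apply: val_inj].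
  by rewrite (_ : Ordinal lt = 1); [rewrite /s /t; field | apply: val_inj].
by apply: memv_img; apply: memvf.
Qed.

(** A common nonzero vector [v] would make [sin_angle v v = 0] positive. *)
Lemma irrational_ell_kernel (R : realType) (a : R) :
  0 < a -> a < 1 -> root (quintic R) a ->
  irrational_subspaces 3 2 1 (ell_kernel a).
Proof.
move=> a0 a1 ra; split=> [|B ratB]; first exact: dim_ell_kernel.
have [K K0 sep] := sin_angle_lower_bound a0 a1 ra.
rewrite ltnS leqn0 dimv_eq0 -subv0; apply/subvP => v; rewrite memv_cap memv0.
case/andP=> /ell_kernelP[av a2v] vB; apply: contraT => v0.
have := sep B v v ratB v0 av a2v vB v0; rewrite leNgt /sin_angle /wedge_norm.
rewrite big1 ?sqrtr0 ?mul0r ?K0 // => i _; rewrite big1 // => j _.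
by rewrite mulrC subrr expr0n.
Qed.

Lemma vspace_neq0P (K : fieldType) (vT : vectType K) (U : {vspace vT}) :
  (0 < \dim U)%N -> exists2 v, v \in U & v != 0.
Proof.
by rewrite lt0n dimv_eq0 -vpick0 => v0; exists (vpick U) => //; apply: memv_pick.
Qed.

(** From [K <= psi_1(A, B) H^5] and [psi_1(A, B) <= H^-6] follows
    [H <= K^-1], a bound that leaves finitely many planes. *)
Lemma exponent_ell_kernel (R : realType) (a : R) :
  0 < a -> a < 1 -> root (quintic R) a ->
  (exponent (ell_kernel a) 2 1 <= 6%:E)%E.
Proof.
move=> a0 a1 ra; have [K K0 sep] := sin_angle_lower_bound a0 a1 ra.
have psi_ge B : rational_subspaces 2 B ->
    K <= psi 1 (ell_kernel a) B * height 2 B ^+ 5 /\ 1 <= height 2 B.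
  move=> ratB; have [w [_ [i [j odd_wij]] wle]] := primitive_plucker_matrix ratB.
  have h1 : 1 <= height 2 B.
    apply: le_trans (wle i j); rewrite -intr_norm ler1z -gtz0_ge1 normr_gt0.
    by apply: contraNneq odd_wij => ->.
  have h0 : 0 < height 2 B ^+ 5 by rewrite exprn_gt0 // (lt_le_trans ltr01).
  split=> //; rewrite -ler_pdivrMr //; apply: lb_le_inf => [|_ [[x y] /= adm <-]].
    have [|x xA x0] := @vspace_neq0P _ _ (ell_kernel a); first by rewrite dim_ell_kernel.
    have [|y yB y0] := @vspace_neq0P _ _ B; first by case: ratB => _ ->.
    by exists (sin_angle x y), (x, y).
  case: adm => /= /ell_kernelP[ax a2x] x0 yB y0 _.
  by rewrite ler_pdivrMr //; apply: sep.
apply: ge_ereal_sup => _ [b /= [b0 inf_b] <-]; rewrite lee_fin leNgt.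
apply/negP => b6; apply: inf_b.
apply: sub_finite_set (finite_height_le 5 K^-1) => B [ratB psi_le]; split=> //.
have [Kle h1] := psi_ge B ratB.
have h0 : 0 < height 2 B by apply: lt_le_trans h1.
have : psi 1 (ell_kernel a) B <= (height 2 B ^+ 6)^-1.
  apply: le_trans psi_le _; rewrite -(powR_mulrn _ (ltW h0)) -powRN.
  by rewrite ler_powR // lerN2 ltW.
move=> /(ler_wpM2r (ltW (exprn_gt0 5 h0)))/(le_trans Kle).
rewrite [_ ^+ 6]exprS invfM mulfVK ?gt_eqF ?exprn_gt0 // => Kh.
by rewrite -[height 2 B]invrK lef_pV2 // posrE invr_gt0.
Qed.

Theorem mainTheorem2 (R : realType) :
  (min_exponent R 5 3 2 1 <= 6%:E)%E.
Proof.
have [a [a0 a1 ra]] := quintic_root R.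
apply: le_trans (exponent_ell_kernel a0 a1 ra).
apply: ereal_inf_lbound; exists (ell_kernel a) => //.
exact: irrational_ell_kernel.
Qed.
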